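(* Let $(\mathcal{E},\|\cdot\|)$ be a normed vector space, let $\gamma>0$, and let $T:\mathcal{E}\to\mathcal{E}$ be $\gamma$-Lipschitz. Let $\lambda\in(0,1)$, let $x_0\in\mathcal{E}$, and define $x_{k+1}=\lambda x_0+(1-\lambda)T(x_k)$ for $k\ge 0$. Then for all $k\ge 1$, $$\|T(x_k)-x_k\|\le (1-\lambda)^k\gamma^k\|T(x_0)-x_0\|+\frac{\lambda}{1-\lambda}\|x_0-x_k\|.$$ If $\gamma\in(0,1]$ and $x_*$ is a fixed point of $T$, then further $$\|T(x_k)-x_k\|\le (1-\lambda)^k\gamma^k\|T(x_0)-x_0\|+\frac{2\lambda}{1-\lambda}\|x_0-x_*\|.$$ As a consequence, for $\gamma\in(0,1]$ and given any $\epsilon>0$, if $\lambda=\frac{\epsilon}{4D_*+\epsilon}$, where $D_*\ge\|x_0-x_*\|$, then $\|T(x_k)-x_k\|\le\epsilon$ after at most $k$ iterations, where $$k=\Big\lceil\frac{\ln(2\|T(x_0)-x_0\|/\epsilon)}{\ln(1/(1-\lambda))+\ln(1/\gamma)}\Big\rceil=\mathcal{O}\Big(\frac{\ln(\|T(x_0)-x_0\|/\epsilon)}{\epsilon/D_*+\ln(1/\gamma)}\Big).$$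
   Context: $T$ is $\gamma$-Lipschitz if $\|T(x)-T(y)\|\le\gamma\|x-y\|$ for all $x,y\in\mathcal{E}$. A fixed point of $T$ is a point $x_*$ with $T(x_* )=x_*$. $f=\mathcal{O}(g)$ means that there is a constant $C>0$, independent of $f,g$, with $f\le Cg$.
   Formalization: The O-bound fails for unrestricted parameters (T=-id on R, x_0=1, D_*=1, ε=2 gives k=2 but argument 0); it is proved for ‖T(x_0)-x_0‖/ε ≥ r > 1 and the O-argument ≥ m > 0, with C depending only on r and m. *)

(* Defs.v *)
From HB Require Import structures.
From mathcomp Require Export all_boot all_order all_algebra.
From mathcomp Require Export all_classical all_reals all_analysis.
Export Order.TTheory GRing.Theory Num.Theory.
Export numFieldNormedType.Exports.

Set Implicit Arguments.
Unset Strict Implicit.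
Unset Printing Implicit Defensive.

Local Open Scope ring_scope.

Fixpoint halpern (R : realType) (E : normedModType R) (lam : R) (T : E -> E)
    (x0 : E) (k : nat) : E :=
  if k is k'.+1 then lam *: x0 + (1 - lam) *: T (halpern lam T x0 k') else x0.

(* The argument a stands for `|T x0 - x0|. The value is an integer because the
   logarithm is negative when 2 * a < eps; it is 0 when a = 0, as ln 0 = 0. *)
Definition iteration_bound (R : realType) (gam lam a eps : R) : int :=
  Num.ceil (ln (2 * a / eps) / (ln (1 / (1 - lam)) + ln (1 / gam))).

Definition complexity (R : realType) (gam a eps D : R) : R :=
  ln (a / eps) / (eps / D + ln (1 / gam)).

(* iteration_bound = O(complexity) with a constant C chosen before the space,
   the map, the points and the parameters gam, lam, eps and D.
   The inequality iteration_bound <= C * complexity cannot hold without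
   restriction: for T = -id on R, x0 = 1, gam = D = 1 and eps = 2 it reads
   2 <= C * 0. It is therefore required uniformly on every regime
     r <= a / eps,  m <= complexity      (r > 1, m > 0).
   For r <= a / eps the iteration bound is at least 1, so a lower bound on
   complexity is forced by the conclusion; a / eps -> 1 makes the quotient of
   the two unbounded. For fixed a > 0, gam and D both conditions hold, whatever
   r and m, as soon as eps > 0 is small enough. *)
Definition iteration_bound_bigO (R : realType) : Prop :=
  forall r m : R, 1 < r -> 0 < m ->
  exists2 C : R, 0 < C &
    forall (E : normedModType R) (gam : R) (T : E -> E) (lam : R) (x0 : E)
      (xs : E) (eps D : R),
    0 < gam -> gam.-lipschitz T -> 0 < lam < 1 ->
    gam <= 1 -> T xs = xs ->
    0 < eps -> `|x0 - xs| <= D -> lam = eps / (4 * D + eps) ->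
    r <= `|T x0 - x0| / eps -> m <= complexity gam `|T x0 - x0| eps D ->
    (iteration_bound gam lam `|T x0 - x0| eps)%:~R
      <= C * complexity gam `|T x0 - x0| eps D.

(* Main.v *)
Require Import Defs.
From mathcomp Require Import ring lra.

Set Implicit Arguments.
Unset Strict Implicit.
Unset Printing Implicit Defensive.

Local Open Scope ring_scope.

(** Write [x k] for the iterates, [a] for [`|T x0 - x0|] and [q] for
    [(1 - lam) * gam].  Consecutive iterates differ by
    [x k.+2 - x k.+1 = (1 - lam) *: (T (x k.+1) - T (x k))], so the steps decay
    geometrically: [`|x k.+1 - x k| <= q ^+ k * ((1 - lam) * a)]
    ([norm_halpern_step]).  The definition of [x k.+1] rearranges to
    [(1 - lam) *: (T (x k) - x k) = (x k.+1 - x k) + lam *: (x k - x0)], and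
    dividing its norm by [1 - lam] gives the first bound
    ([halpern_residual]).  When [gam <= 1] and [T xs = xs], the iterates stay in
    the ball of centre [xs] and radius [`|x0 - xs|] ([halpern_bounded]), hence
    [`|x0 - x k| <= 2 * `|x0 - xs|] and the second bound.

    With [lam = eps / (4 * D + eps)] one has [lam / (1 - lam) = eps / (4 * D)],
    so the second term is at most [eps / 2], and the first is at most [eps / 2]
    as soon as [ln (2 * a / eps) <= n * ln (1 / q)].

    For the asymptotic comparison put [t = eps / D] and [g = ln (1 / gam)].
    Since [a <= 2 * D] and [a > eps], the ratio [t] is less than [2]; therefore
    [ln (1 / (1 - lam)) >= lam = t / (4 + t) >= t / 6], and the denominator of
    the iteration bound is at least [(t + g) / 6].  In the numerator
    [ln (2 * a / eps) = ln 2 + ln (a / eps) <= (1 + ln 2 / ln r) * ln (a / eps)],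
    and the unit lost by rounding up is at most [1 / m] times the complexity. *)

(** * Residual bounds for the Halpern iteration *)

Section Halpern.
Variables (R : realType) (E : normedModType R) (gam lam : R).
Variables (T : E -> E) (x0 : E).
Hypotheses (gam0 : 0 < gam) (lam0 : 0 < lam) (lam1 : lam < 1).
Hypothesis lipT : forall y z, `|T y - T z| <= gam * `|y - z|.

Local Notation x := (halpern lam T x0).
Local Notation q := ((1 - lam) * gam).

Let mu_gt0 : 0 < 1 - lam. Proof. by rewrite subr_gt0. Qed.
Let q_gt0 : 0 < q. Proof. exact: mulr_gt0. Qed.

Lemma halpernS (k : nat) : x k.+1 = lam *: x0 + (1 - lam) *: T (x k).
Proof. by []. Qed.

Lemma norm_halpern_step (k : nat) :
  `|x k.+1 - x k| <= q ^+ k * ((1 - lam) * `|T x0 - x0|).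
Proof.
elim: k => [|k IHk].
  have -> : x 1 - x 0 = (1 - lam) *: (T x0 - x0).
    rewrite halpernS /= scalerBr [(1 - lam) *: x0]scalerBl scale1r opprB.
    by rewrite [lam *: x0 + _]addrC addrA.
  by rewrite normrZ gtr0_norm // expr0 mul1r.
have -> : x k.+2 - x k.+1 = (1 - lam) *: (T (x k.+1) - T (x k)).
  rewrite halpernS [X in _ - X = _]halpernS opprD addrACA subrr add0r.
  by rewrite -scalerBr.
rewrite normrZ gtr0_norm // exprS -mulrA.
apply: (@le_trans _ _ (q * `|x k.+1 - x k|)); last by rewrite ler_pM2l.
by rewrite -mulrA ler_pM2l.
Qed.

Lemma halpern_residual (k : nat) :
  `|T (x k) - x k| <= (1 - lam) ^+ k * gam ^+ k * `|T x0 - x0|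
                      + lam / (1 - lam) * `|x0 - x k|.
Proof.
have E1 : (1 - lam) *: (T (x k) - x k) =
    (x k.+1 - x k) + lam *: (x k - x0).
  rewrite halpernS !scalerBr [(1 - lam) *: x k]scalerBl scale1r opprB.
  rewrite [lam *: x0 + _]addrC -!addrA; congr (_ + _).
  by rewrite [RHS]addrC -!addrA addNr addr0 addrC.
have E2 : (1 - lam) * `|T (x k) - x k| <=
    (1 - lam) * (q ^+ k * `|T x0 - x0|) + lam * `|x0 - x k|.
  rewrite -[X in X * `|_ - x k|]gtr0_norm // -normrZ E1.
  apply: (le_trans (ler_normD _ _)); apply: lerD.
    by rewrite mulrCA norm_halpern_step.
  by rewrite normrZ gtr0_norm // distrC.
rewrite -(ler_pM2l mu_gt0) -exprMn mulrDr.
by rewrite [(1 - lam) * (lam / _ * _)]mulrA [_ * (lam / _)]mulrC divfK ?gt_eqF.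
Qed.

Section FixedPoint.
Variable xs : E.
Hypotheses (gam1 : gam <= 1) (Txs : T xs = xs).

Let nonexp (y : E) : `|T y - xs| <= `|y - xs|.
Proof.
rewrite -{1}Txs; apply: (le_trans (lipT _ _)).
by rewrite ler_piMl.
Qed.

Lemma fixed_point_residual : `|T x0 - x0| <= 2 * `|x0 - xs|.
Proof.
apply: (le_trans (ler_distD xs _ _)).
by rewrite [`|xs - x0|]distrC mulr_natl mulr2n lerD2r nonexp.
Qed.

Lemma halpern_bounded (k : nat) : `|x k - xs| <= `|x0 - xs|.
Proof.
elim: k => [//|k IHk].
have -> : x k.+1 - xs = lam *: (x0 - xs) + (1 - lam) *: (T (x k) - xs).
  rewrite halpernS !scalerBr addrACA -opprD -scalerDl.
  by rewrite [lam + _]addrC subrK scale1r.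
apply: (le_trans (ler_normD _ _)).
rewrite !normrZ !gtr0_norm //.
have H : (1 - lam) * `|T (x k) - xs| <= (1 - lam) * `|x0 - xs|.
  by rewrite ler_pM2l // (le_trans (nonexp _)).
by apply: (le_trans (lerD (lexx _) H)); rewrite -mulrDl addrC subrK mul1r.
Qed.

Lemma halpern_residual_fixed_point (k : nat) :
  `|T (x k) - x k| <= (1 - lam) ^+ k * gam ^+ k * `|T x0 - x0|
                      + 2 * lam / (1 - lam) * `|x0 - xs|.
Proof.
apply: (le_trans (halpern_residual k)); rewrite lerD2l.
rewrite [leRHS](_ : _ = lam / (1 - lam) * (2 * `|x0 - xs|)); last by ring.
rewrite ler_pM2l ?divr_gt0 //.
apply: (le_trans (ler_distD xs _ _)).
by rewrite [`|xs - _|]distrC mulr_natl mulr2n lerD2l halpern_bounded.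
Qed.

End FixedPoint.
End Halpern.

(** * The iteration bound and its order of growth *)

Section Bounds.
Variables (R : realType) (gam lam eps D : R).
Hypotheses (gam0 : 0 < gam) (gam1 : gam <= 1).
Hypotheses (lam0 : 0 < lam) (lam1 : lam < 1).
Hypotheses (eps0 : 0 < eps) (D0 : 0 <= D) (lamE : lam = eps / (4 * D + eps)).

Lemma ln_inv_ge0 : 0 <= ln (1 / gam).
Proof. by rewrite ln_ge0 // div1r invf_ge1. Qed.

Lemma ln_inv_1sub_ge : lam <= ln (1 / (1 - lam)).
Proof.
rewrite div1r lnV ?posrE ?subr_gt0 // lerNr.
by apply: le_ln1Dx; rewrite ltrN2.
Qed.

(** A null radius would make [lam = eps / eps = 1]. *)
Lemma radius_gt0 : 0 < D.
Proof.
rewrite lt_neqAle D0 andbT; apply/eqP => D_eq0.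
by move: lam1; rewrite lamE -D_eq0 mulr0 add0r divff ?gt_eqF // ltxx.
Qed.

Lemma lam_ratio : 2 * lam / (1 - lam) * D = eps / 2.
Proof.
have D_gt0 := radius_gt0; rewrite lamE; field.
have num0 : 0 < 4 * D by exact: mulr_gt0.
by rewrite !gt_eqF ?addrK ?addr_gt0.
Qed.

Lemma iteration_bound_geometric (a : R) (n : nat) :
  0 <= a -> iteration_bound gam lam a eps <= n%:Z ->
  (1 - lam) ^+ n * gam ^+ n * a <= eps / 2.
Proof.
(* When a = 0 the bound says nothing about n, but the left-hand side is 0. *)
rewrite le_eqVlt => /predU1P[<- _|a0]; first by rewrite mulr0 divr_ge0 // ltW.
have mu0 : 0 < 1 - lam by rewrite subr_gt0.
have q0 : 0 < (1 - lam) ^+ n * gam ^+ n by rewrite mulr_gt0 // exprn_gt0.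
have L0 : 0 < ln (1 / (1 - lam)) + ln (1 / gam).
  by rewrite ltr_wpDr ?ln_inv_ge0 // (lt_le_trans lam0) // ln_inv_1sub_ge.
rewrite /iteration_bound ceil_le_int ler_pdivrMr //.
rewrite !div1r !lnV ?posrE // -opprD mulrN -lnM ?posrE //.
rewrite [n%:~R * _]mulr_natl -lnXn ?mulr_gt0 // exprMn -lnV ?posrE //.
rewrite ler_ln ?posrE ?invr_gt0 ?divr_gt0 ?mulr_gt0 ?exprn_gt0 //.
rewrite -[leRHS]mul1r ler_pdivlMr // => H.
rewrite -[leRHS]mul1r -ler_pdivrMr ?divr_gt0 //.
rewrite (_ : _ / _ = 2 * a / eps * ((1 - lam) ^+ n * gam ^+ n)) //.
by field; rewrite gt_eqF.
Qed.

(** The hypotheses [eps < a] and [a <= 2 * D] bound [eps / D] by [2], which is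
    what makes [ln (1 / (1 - lam))] comparable to [eps / D]. *)
Lemma iteration_rate_ge (a : R) : eps < a -> a <= 2 * D ->
  (eps / D + ln (1 / gam)) / 6 <= ln (1 / (1 - lam)) + ln (1 / gam).
Proof.
move=> lt_eps_a le_aD; have D_gt0 := radius_gt0.
have H : eps / D / 6 <= lam.
  rewrite lamE -mulrA ler_pM2l // -invfM lef_pV2 ?posrE ?addr_gt0 ?mulr_gt0 //.
  clear lamE; lra.
rewrite mulrDl; apply: lerD; first exact: le_trans ln_inv_1sub_ge.
by rewrite ler_pdivrMr // ler_peMr ?ln_inv_ge0 // ler1n.
Qed.

Lemma iteration_bound_le_complexity (r m a : R) :
  1 < r -> 0 < m -> a <= 2 * D -> r <= a / eps ->
  m <= complexity gam a eps D ->
  (iteration_bound gam lam a eps)%:~R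
    <= (6 * (1 + ln 2 / ln r) + 1 / m) * complexity gam a eps D.
Proof.
move=> r1 m0 aD ra mc; have D_gt0 := radius_gt0.
have lnr0 := ln_gt0 r1.
have ae1 : 1 < a / eps by exact: lt_le_trans ra.
have lt_eps_a : eps < a by rewrite -[eps]mul1r -ltr_pdivlMr.
have rate := iteration_rate_ge lt_eps_a aD.
have d0 : 0 < eps / D + ln (1 / gam).
  by rewrite ltr_wpDr ?ln_inv_ge0 ?divr_gt0.
have ae0 : 0 < a / eps by exact: lt_trans ae1.
have ln2 : 0 <= ln 2 :> R by rewrite ln_ge0 // ler1n.
have lnra : ln r <= ln (a / eps) by rewrite ler_ln ?posrE ?(lt_trans _ r1).
have num : ln (2 * a / eps) <= (1 + ln 2 / ln r) * ln (a / eps).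
  rewrite -mulrA lnM ?posrE // mulrDl mul1r addrC lerD2l.
  by rewrite -mulrA ler_peMr // mulrC ler_pdivlMr // mul1r.
have num0 : 0 <= (1 + ln 2 / ln r) * ln (a / eps).
  by rewrite mulr_ge0 ?ltW ?ln_gt0 // ltr_wpDr ?divr_ge0 // ltW.
have L0 : 0 < ln (1 / (1 - lam)) + ln (1 / gam).
  by apply: lt_le_trans rate; rewrite divr_gt0.
have main : ln (2 * a / eps) / (ln (1 / (1 - lam)) + ln (1 / gam))
    <= 6 * (1 + ln 2 / ln r) * complexity gam a eps D.
  rewrite ler_pdivrMr //; apply: (le_trans num).
  rewrite (_ : 6 * _ * _ * _ = (1 + ln 2 / ln r) * ln (a / eps) *
    ((ln (1 / (1 - lam)) + ln (1 / gam)) / ((eps / D + ln (1 / gam)) / 6))).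
    rewrite ler_peMr // ler_pdivlMr; last exact: divr_gt0.
    by rewrite [leLHS]mul1r.
  rewrite /complexity; move: (eps / D + _) (1 + _) (ln _ + _) d0 => d c L d_gt0.
  by field; rewrite gt_eqF.
have ceil1 : (iteration_bound gam lam a eps)%:~R <=
    ln (2 * a / eps) / (ln (1 / (1 - lam)) + ln (1 / gam)) + 1.
  rewrite /iteration_bound -lerBlDr -(intrD _ _ (-1)) ltW //.
  by case/andP: (ceil_itv
    (ln (2 * a / eps) / (ln (1 / (1 - lam)) + ln (1 / gam)))).
(* The complexity is at least m, so it absorbs the 1 lost by rounding up. *)
apply: (le_trans ceil1); rewrite [leRHS]mulrDl; apply: lerD => //.
by rewrite mulrC mulrA mulr1 ler_pdivlMr // mul1r.
Qed.

End Bounds.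

Theorem lemma1 (R : realType) :
  (forall (E : normedModType R) (gam : R) (T : E -> E) (lam : R) (x0 : E),
    0 < gam -> gam.-lipschitz T -> 0 < lam < 1 ->
    let x := halpern lam T x0 in
    [/\ forall k : nat, (1 <= k)%N ->
          `|T (x k) - x k| <= (1 - lam) ^+ k * gam ^+ k * `|T x0 - x0|
                              + lam / (1 - lam) * `|x0 - x k|,
        forall xs : E, gam <= 1 -> T xs = xs ->
        forall k : nat, (1 <= k)%N ->
          `|T (x k) - x k| <= (1 - lam) ^+ k * gam ^+ k * `|T x0 - x0|
                              + 2 * lam / (1 - lam) * `|x0 - xs|
      & forall (xs : E) (eps D : R), gam <= 1 -> T xs = xs ->
          0 < eps -> `|x0 - xs| <= D -> lam = eps / (4 * D + eps) ->
        forall n : nat, iteration_bound gam lam `|T x0 - x0| eps <= n%:Z ->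
          `|T (x n) - x n| <= eps])
  /\ iteration_bound_bigO R.
Proof.
have lipschitzE (E : normedModType R) (gam : R) (T : E -> E) :
    gam.-lipschitz T -> forall x y, `|T x - T y| <= gam * `|x - y|.
  by move=> lipT x y; exact: (lipT (x, y)).
split=> [E gam T lam x0 gam0 /lipschitzE lipT /andP[lam0 lam1] x|].
  split=> [k _|xs gam1 Txs k _|xs eps D gam1 Txs eps0 xD lamE n nN].
  - exact: halpern_residual.
  - exact: halpern_residual_fixed_point.
  have D0 : 0 <= D by exact: le_trans xD.
  rewrite /x.
  apply: (le_trans (halpern_residual_fixed_point x0 gam0 lam0 lam1 lipT gam1
    Txs n)).
  rewrite [leRHS]splitr; apply: lerD.
    exact: iteration_bound_geometric nN.
  rewrite -(lam_ratio lam1 eps0 D0 lamE) ler_pM2l //.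
  by rewrite divr_gt0 ?mulr_gt0 // subr_gt0.
move=> r m r1 m0; exists (6 * (1 + ln 2 / ln r) + 1 / m).
  rewrite addr_gt0 ?divr_gt0 // mulr_gt0 // ltr_wpDr // divr_ge0 //.
    by rewrite ln_ge0 // ler1n.
  by rewrite ltW // ln_gt0.
move=> E gam T lam x0 xs eps D gam0 /lipschitzE lipT /andP[lam0 lam1] gam1 Txs.
move=> eps0 xD lamE ra mc.
have D0 : 0 <= D by exact: le_trans xD.
apply: iteration_bound_le_complexity => //.
apply: (le_trans (fixed_point_residual x0 lipT gam1 Txs)).
by rewrite ler_pM2l.
Qed.
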